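(* For any integer $n\ge 1$ and any integer $m\ge 0$, $$\sum_{k_{m+1}=1}^{n}\cdots\sum_{k_2=1}^{k_3}\sum_{k_1=1}^{k_2}\frac{1}{k_1}=\sum_{k=1}^{n}\frac{(-1)^{k+1}}{k}\binom{m+n}{m+k}.$$
   Context: The left-hand side is an $(m+1)$-fold nested sum over integers $1\le k_1\le k_2\le\cdots\le k_{m+1}\le n$ with summand $1/k_1$; for $m=0$ it is $\sum_{k_1=1}^{n}\frac{1}{k_1}$. *)

(* Defs.v *)
From mathcomp Require Import all_boot all_order all_algebra.
Set Implicit Arguments.
Unset Strict Implicit.
Unset Printing Implicit Defensive.
Import GRing.Theory.
Local Open Scope ring_scope.

(* The (m+1)-fold nested sum, by recursion from the outermost index:
   [nested_sum m n] is the sum over k_{m+1} from 1 to n of ... of the sum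
   over k_1 from 1 to k_2 of 1 / k_1. *)
Fixpoint nested_sum (m n : nat) : rat :=
  if m is m'.+1 then \sum_(1 <= k < n.+1) nested_sum m' k
  else \sum_(1 <= k < n.+1) 1 / k%:R.

(* Main.v *)
(* By Pascal's rule the right-hand side [a m n] satisfies
   [a m.+1 n.+1 - a m.+1 n = a m n.+1], which is the recursion of the nested sum.
   For [m = 0] the increment is [\sum_k (-1)^(k+1) / k * 'C(n, k-1)]; absorbing
   [1 / k] into the binomial makes it [1 / (n+1)] times an alternating row sum
   of Pascal's triangle without its first term. *)
Require Import Defs.
From mathcomp Require Import all_boot all_order all_algebra.
Set Implicit Arguments.
Unset Strict Implicit.
Unset Printing Implicit Defensive.
Import GRing.Theory.
Local Open Scope ring_scope.

Definition alt_binom_sum (m n : nat) : rat :=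
  \sum_(1 <= k < n.+1) (-1) ^+ k.+1 / k%:R * 'C(m + n, m + k)%:R.

Lemma alt_binom_sum_recr (m n : nat) :
  alt_binom_sum m n.+1 = alt_binom_sum m n +
    \sum_(1 <= k < n.+2) (-1) ^+ k.+1 / k%:R * 'C(m + n, (m + k).-1)%:R.
Proof.
(* The added term at [k = n.+1] vanishes, as [m + n < m + n.+1]; the two sums then share a range. *)
have -> : alt_binom_sum m n =
    \sum_(1 <= k < n.+2) (-1) ^+ k.+1 / k%:R * 'C(m + n, m + k)%:R.
  by rewrite [RHS]big_nat_recr //= [X in _ + X]mulrC bin_small ?mul0r ?addr0 // addnS.
rewrite -big_split /=; apply: eq_big_nat => -[|k] // _.
by rewrite !addnS binS natrD mulrDr.
Qed.

Lemma alt_binom_sumS (m n : nat) :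
  alt_binom_sum m.+1 n = \sum_(1 <= k < n.+1) alt_binom_sum m k.
Proof.
elim: n => [|n IHn]; first by rewrite /alt_binom_sum !big_geq.
rewrite alt_binom_sum_recr IHn [RHS]big_nat_recr //=; congr (_ + _).
(* Here [(m.+1 + k).-1] is [m + k], and [m.+1 + n] equals [m + n.+1]. *)
by apply: eq_bigr => k _; rewrite addSnnS.
Qed.

(** Expand [(1 - 1) ^+ n.+1 = 0] and move the term at [k = 0], which is 1, to the other side. *)
Lemma alternating_bin_sum (R : pzRingType) (n : nat) :
  \sum_(1 <= k < n.+2) (-1) ^+ k.+1 * 'C(n.+1, k)%:R = 1 :> R.
Proof.
have := exprBn_comm n.+1 (commr1 (1 : R)).
rewrite subrr expr0n /= -(big_mkord xpredT
  (fun i => (-1) ^+ i * 1 ^+ (n.+1 - i) * 1 ^+ i *+ 'C(n.+1, i))).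
rewrite big_ltn // bin0 !expr1n !mulr1 expr0 => /esym/eqP.
rewrite addrC addr_eq0 => /eqP row.
apply: oppr_inj; rewrite -[RHS]row -sumrN; apply: eq_bigr => k _.
by rewrite !expr1n !mulr1 exprS mulN1r mulNr opprK mulr_natr.
Qed.

Lemma bin_div_absorb (F : numFieldType) (n k : nat) :
  'C(n, k)%:R / k.+1%:R = 'C(n.+1, k.+1)%:R / n.+1%:R :> F.
Proof.
apply/eqP; rewrite eqr_div ?Num.Theory.pnatr_eq0 // -!natrM.
by rewrite mulnC mul_bin_diag mulnC.
Qed.

Lemma alt_binom_sum0 (n : nat) :
  alt_binom_sum 0 n = \sum_(1 <= k < n.+1) 1 / k%:R.
Proof.
elim: n => [|n IHn]; first by rewrite /alt_binom_sum !big_geq.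
rewrite alt_binom_sum_recr IHn [RHS]big_nat_recr //=; congr (_ + _).
(* Expanding the numerator 1 as an alternating row sum lets both sides be compared termwise. *)
rewrite -[X in _ = X / _](alternating_bin_sum _ n) mulr_suml.
apply: eq_big_nat => -[|k] // _.
by rewrite !add0n succnK mulrAC -mulrA bin_div_absorb mulrA.
Qed.

Theorem theorem4p2 (n m : nat) (hn : (1 <= n)%N) :
  nested_sum m n =
  \sum_(1 <= k < n.+1) (-1) ^+ k.+1 / k%:R * 'C(m + n, m + k)%:R.
Proof.
(* The inner sums stop at varying [k], so the induction on [m] quantifies over [n]. *)
rewrite -/(alt_binom_sum m n); move: n {hn}.
elim: m => [|m IHm] n; first by rewrite alt_binom_sum0.
by rewrite alt_binom_sumS /=; apply: eq_bigr => k _.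
Qed.
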